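(* Let $S$ be a finite semigroup and $\mathbb B$ the boolean semiring. Then the minimal and irreducible $\mathbb BS$-modules are obtained (up to isomorphism) as follows. Fix a regular $\mathscr J$-class $J$ of $S$ with set $A$ of $\mathscr R$-classes and set $B$ of $\mathscr L$-classes. Let $C\colon B\times A\to\mathbb B$ be the matrix with $C_{ba}=1$ if and only if the $\mathscr H$-class $a\cap b$ contains an idempotent. Let $\mathbb BB$ be the free $\mathbb B$-module on $B$ with the natural right action of $S$. Define a congruence $\equiv$ on $\mathbb BB$ by putting $m\equiv n$ if, for all $s\in S$, $ms=0\iff ns=0$. Then: (1) The congruence $\equiv$ is the unique maximal proper congruence on $\mathbb BB$. (2) The module $\mathbb BB$ is minimal, as is every quotient of $\mathbb BB$ by a proper congruence. (3) $\mathbb BB/{\equiv}$ is irreducible, and all irreducible $\mathbb BS$-modules are of this form for some regular $\mathscr J$-class. That is, the minimal $\mathbb BS$-modules are, up to isomorphism, the quotients of the modules $\mathbb BB$ by proper congruences, and the irreducible ones are the modules $\mathbb BB/{\equiv}$, as $J$ runs over the regular $\mathscr J$-classes of $S$. Alternatively, $\mathbb BB/{\equiv}$ can be identified with the $\mathbb B$-span of the rows of the matrix $C$.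
   Context: $\mathbb B=\{0,1\}$ is the boolean semiring ($1+1=1$). A $\mathbb B$-module is a commutative idempotent additive monoid with zero (equivalently a join semilattice with minimum $0$). $\mathbb BS$ is the semigroup algebra of $S$ over $\mathbb B$; a right $\mathbb BS$-module is a $\mathbb B$-module with a right action of $S$ by additive maps preserving $0$ (unitary if $\mathbb BS$ is unital). A congruence on a module is an equivalence relation compatible with addition and the action; it is proper if it has more than one class and trivial if all classes are singletons. A module $M$ with $M\cdot\mathbb BS\ne0$ is simple if its only proper congruence is the trivial one, minimal if its only submodules are $0$ and $M$, and irreducible if it is both. Green's relations on $S$ (with $S^1$ denoting $S$ with an adjoined identity): $s\mathrel{\mathscr J}t$ iff $S^1sS^1=S^1tS^1$; $s\mathrel{\mathscr R}t$ iff $sS^1=tS^1$; $s\mathrel{\mathscr L}t$ iff $S^1s=S^1t$; $\mathscr H=\mathscr R\cap\mathscr L$. A $\mathscr J$-class is regular if it contains an idempotent. The natural right action of $S$ on $\mathbb BB$ is given on basis elements by: if $b$ is the $\mathscr L$-class of $x\in J$, then $bs$ is the $\mathscr L$-class of $xs$ if $xs\in J$, and $bs=0$ otherwise. *)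

(* Defs.v *)
From HB Require Import structures.
From mathcomp Require Import all_boot ssralg.

Set Implicit Arguments.
Unset Strict Implicit.
Unset Printing Implicit Defensive.

(* Declared before fingroup is loaded: Hierarchy-Builder does not accept a new
   structure below the already declared finStarMonoidType. *)
#[short(type="finSemigroupType")]
HB.structure Definition FinSemigroup := {S of Finite S & Semigroup S}.

From mathcomp Require Import boolp.

Import GRing.Theory.
Local Open Scope ring_scope.

(* The type [bool] itself carries the field structure of F_2 in MathComp, so
   the boolean semiring (1 + 1 = 1) lives on a wrapper. *)
Record boolsr : Type := BoolSR { bool_of_boolsr :> bool }.
HB.instance Definition _ := [isNew for bool_of_boolsr].
HB.instance Definition _ := [Finite of boolsr by <:].

Section BooleanSemiring.
Implicit Types x y z : boolsr.

Definition boolsr_add x y : boolsr := BoolSR (x || y).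
Definition boolsr_mul x y : boolsr := BoolSR (x && y).

Lemma boolsr_addA : associative boolsr_add.
Proof. by move=> [[]] [[]] [[]]. Qed.
Lemma boolsr_addC : commutative boolsr_add.
Proof. by move=> [[]] [[]]. Qed.
Lemma boolsr_add0 : left_id (BoolSR false) boolsr_add.
Proof. by move=> [[]]. Qed.

HB.instance Definition _ := GRing.isNmodule.Build boolsr
  boolsr_addA boolsr_addC boolsr_add0.

Lemma boolsr_mulA : associative boolsr_mul.
Proof. by move=> [[]] [[]] [[]]. Qed.
Lemma boolsr_mulC : commutative boolsr_mul.
Proof. by move=> [[]] [[]]. Qed.
Lemma boolsr_mul1 : left_id (BoolSR true) boolsr_mul.
Proof. by move=> [[]]. Qed.
Lemma boolsr_mulDl : left_distributive boolsr_mul boolsr_add.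
Proof. by move=> [[]] [[]] [[]]. Qed.
Lemma boolsr_mul0 : left_zero (BoolSR false) boolsr_mul.
Proof. by move=> [[]]. Qed.
Lemma boolsr_1neq0 : BoolSR true != BoolSR false.
Proof. by []. Qed.

HB.instance Definition _ := GRing.Nmodule_isComNzSemiRing.Build boolsr
  boolsr_mulA boolsr_mulC boolsr_mul1 boolsr_mulDl boolsr_mul0 boolsr_1neq0.

End BooleanSemiring.

(* Elements of the semigroup algebra are functions S -> boolsr under
   convolution; the pointwise product that the library puts on {ffun _} is not
   used. *)
Notation salg S := {ffun S -> boolsr^o}.

Definition salg_mul (S : finSemigroupType) (f g : salg S) : salg S :=
  [ffun u => \sum_(p : S * S | (p.1 * p.2)%g == u) f p.1 * g p.2].

Definition salg_identity (S : finSemigroupType) (e : salg S) : Prop :=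
  forall f : salg S, salg_mul e f = f /\ salg_mul f e = f.

(* A boolsr-module is an lSemiModType over boolsr: addition is idempotent since
   x + x = (1 + 1) *: x, see [addxx].  The last axiom is unitarity, which is
   void when the semigroup algebra has no identity. *)
HB.mixin Record isRightModule (S : finSemigroupType) M
    of GRing.LSemiModule boolsr M := {
  rmact : M -> S -> M;
  rmactM : forall m s t, rmact m (s * t)%g = rmact (rmact m s) t;
  rmactD : forall m n s, rmact (m + n) s = rmact m s + rmact n s;
  rmact0 : forall s, rmact 0 s = 0;
  rmact_unitary : forall e : salg S, salg_identity e ->
    forall m, \sum_(s : S) e s *: rmact m s = m
}.

#[short(type="rmodType")]
HB.structure Definition RightModule (S : finSemigroupType) :=
  {M of GRing.LSemiModule boolsr M & isRightModule S M}.

Section ModuleNotions.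
Variable S : finSemigroupType.
Implicit Types M N : rmodType S.

Definition salg_act M (m : M) (f : salg S) : M := \sum_(s : S) f s *: rmact m s.

Definition nonzero_action M : Prop :=
  exists (m : M) (f : salg S), salg_act m f <> 0.

Record congruence M := Congruence {
  cong_rel :> M -> M -> Prop;
  cong_refl : forall x, cong_rel x x;
  cong_sym : forall x y, cong_rel x y -> cong_rel y x;
  cong_trans : forall x y z, cong_rel x y -> cong_rel y z -> cong_rel x z;
  congD : forall x y x' y',
    cong_rel x y -> cong_rel x' y' -> cong_rel (x + x') (y + y');
  cong_rmact : forall x y s, cong_rel x y -> cong_rel (rmact x s) (rmact y s)
}.

Definition proper_cong M (E : congruence M) : Prop := exists x y, ~ E x y.

Definition trivial_cong M (E : congruence M) : Prop := forall x y, E x y -> x = y.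

Definition cong_le M (E F : congruence M) : Prop := forall x y, E x y -> F x y.

Definition cong_eq M (E F : congruence M) : Prop := forall x y, E x y <-> F x y.

Definition maximal_proper M (E : congruence M) : Prop :=
  proper_cong E /\
  forall F : congruence M, proper_cong F -> cong_le E F -> cong_eq F E.

Definition unique_maximal_proper M (E : congruence M) : Prop :=
  maximal_proper E /\
  forall F : congruence M, maximal_proper F -> cong_eq F E.

Record submodule M := Submodule {
  submod_mem :> M -> Prop;
  submod0 : submod_mem 0;
  submodD : forall x y, submod_mem x -> submod_mem y -> submod_mem (x + y);
  submod_act : forall x s, submod_mem x -> submod_mem (rmact x s)
}.

Definition simple_module M : Prop :=
  nonzero_action M /\ forall E : congruence M, proper_cong E -> trivial_cong E.

Definition minimal_module M : Prop :=
  nonzero_action M /\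
  forall N : submodule M, (forall x, N x <-> x = 0) \/ (forall x, N x).

Definition irreducible_module M : Prop := simple_module M /\ minimal_module M.

Definition equivariant M N (f : M -> N) : Prop :=
  forall x s, f (rmact x s) = rmact (f x) s.

Definition isomorphic M N : Prop :=
  exists f : {linear M -> N}, equivariant f /\ bijective f.

End ModuleNotions.

Section BooleanModules.
Variable M : lSemiModType boolsr.

Lemma addxx (x : M) : x + x = x.
Proof. by rewrite -[x in x + x]scale1r -scalerDl; exact: scale1r. Qed.

Lemma scale_boolsr (a : boolsr) (x : M) : a *: x = if a then x else 0.
Proof. by case: a => -[]; [exact: scale1r | exact: scale0r]. Qed.

Lemma addx_eq0 (x y : M) : x + y = 0 <-> x = 0 /\ y = 0.
Proof.
split=> [xy0|[-> ->]]; last by rewrite addr0.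
suff x0 : x = 0 by move: xy0; rewrite x0 add0r.
by rewrite -[LHS]addr0 -xy0 addrA addxx.
Qed.

End BooleanModules.

(* In the boolean semigroup algebra, an identity is supported on identities of
   S; this reduces unitarity to an elementwise condition. *)
Section Unitarity.
Variable S : finSemigroupType.

Lemma boolsr_sum (I : finType) (P : pred I) (F : I -> boolsr^o) :
  \sum_(i | P i) F i = [exists i, P i && F i] :> bool.
Proof.
apply/idP/existsP => [|[i /andP[Pi Fi]]]; last first.
  by rewrite (bigD1 i) //= Fi.
elim/big_ind: _ => //= [x y IHx IHy|i Pi Fi]; first by case/orP.
by exists i; rewrite Pi.
Qed.

Lemma salg_identity_supp (e : salg S) (t : S) :
  salg_identity e -> e t -> forall s : S, (t * s = s /\ s * t = s)%g.
Proof.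
move=> e1 et s; pose d : salg S := [ffun u => BoolSR (u == s)].
have [/ffunP ed /ffunP de] := e1 d; split.
- move/(_ (t * s)%g)/(congr1 bool_of_boolsr): ed.
  rewrite !ffunE boolsr_sum => ed.
  apply/eqP; rewrite -[_ == _]ed; apply/existsP; exists (t, s).
  by rewrite /= eqxx et ffunE eqxx.
- move/(_ (s * t)%g)/(congr1 bool_of_boolsr): de.
  rewrite !ffunE boolsr_sum => de.
  apply/eqP; rewrite -[_ == _]de; apply/existsP; exists (s, t).
  by rewrite /= eqxx et ffunE eqxx.
Qed.

Lemma salg_identity_ex (e : salg S) (s : S) :
  salg_identity e -> exists t : S, e t.
Proof.
move=> e1; pose d : salg S := [ffun u => BoolSR (u == s)].
have [/ffunP/(_ s)/(congr1 bool_of_boolsr)] := e1 d.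
rewrite !ffunE boolsr_sum /= eqxx => + _.
by case/existsP => -[t u] /andP[_ /andP[et _]]; exists t.
Qed.

Lemma unitary_of_identity (M : lSemiModType boolsr) (ac : M -> S -> M) :
  ((S -> False) -> forall m : M, m = 0) ->
  (forall t, (forall s : S, t * s = s /\ s * t = s)%g -> forall m, ac m t = m) ->
  forall e : salg S, salg_identity e ->
  forall m, \sum_(s : S) e s *: ac m s = m.
Proof.
move=> M0 ac1 e e1 m.
have eE s : e s *: ac m s = if e s then m else 0.
  rewrite scale_boolsr; case: ifP => // es.
  by rewrite (ac1 s (salg_identity_supp e1 es)).
rewrite (eq_bigr _ (fun s _ => eE s)) -big_mkcond /=.
case: (pselect (exists s : S, True)) => [[s _]|noS]; last first.
  by rewrite [LHS]M0 ?[RHS]M0 // => s; apply: noS; exists s.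
have [t et] := salg_identity_ex s e1.
rewrite (bigD1 t) //=; elim/big_ind: _ => [|x y IHx IHy|i _]; first exact: addr0.
  by rewrite addrA IHx IHy.
exact: addxx.
Qed.

End Unitarity.

Section Quotient.
Variables (S : finSemigroupType) (M : rmodType S) (E : congruence M).
Local Open Scope quotient_scope.

Definition congb (x y : M) : bool := `[< E x y >].

Lemma congb_refl : reflexive congb.
Proof. by move=> x; apply/asboolP; exact: cong_refl. Qed.

Lemma congb_sym : symmetric congb.
Proof. by move=> x y; apply/asboolP/asboolP; exact: cong_sym. Qed.

Lemma congb_trans : transitive congb.
Proof. by move=> y x z /asboolP xy /asboolP yz; apply/asboolP/(cong_trans xy). Qed.

Canonical cong_equiv := EquivRel congb congb_refl congb_sym congb_trans.

Definition quot : Type := {eq_quot cong_equiv}.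
HB.instance Definition _ := Choice.on quot.
HB.instance Definition _ := EqQuotient.on quot.

Definition quot_pi (x : M) : quot := \pi_quot x.

Lemma quot_piP x y : quot_pi x = quot_pi y <-> E x y.
Proof.
split=> [/eqmodP/asboolP //|Exy].
by apply/eqmodP/asboolP.
Qed.

Lemma quot_pi_surj (q : quot) : exists x, q = quot_pi x.
Proof. by exists (repr q); rewrite /quot_pi reprK. Qed.

Lemma repr_piP x : E (repr (quot_pi x)) x.
Proof. by apply/quot_piP; rewrite /quot_pi reprK. Qed.

Definition quot_zero : quot := quot_pi 0.
Definition quot_add (p q : quot) : quot := quot_pi (repr p + repr q).
Definition quot_scale (a : boolsr) (p : quot) : quot := quot_pi (a *: repr p).
Definition quot_act (p : quot) (s : S) : quot := quot_pi (rmact (repr p) s).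

Lemma quot_addE x y : quot_add (quot_pi x) (quot_pi y) = quot_pi (x + y).
Proof. by apply/quot_piP/congD; exact: repr_piP. Qed.

Lemma quot_scaleE a x : quot_scale a (quot_pi x) = quot_pi (a *: x).
Proof.
apply/quot_piP; rewrite !scale_boolsr; case: ifP => _; last exact: cong_refl.
exact: repr_piP.
Qed.

Lemma quot_actE x s : quot_act (quot_pi x) s = quot_pi (rmact x s).
Proof. by apply/quot_piP/cong_rmact; exact: repr_piP. Qed.

Lemma quot_addA : associative quot_add.
Proof.
move=> p q r; case: (quot_pi_surj p) (quot_pi_surj q) (quot_pi_surj r).
by move=> x -> [y ->] [z ->]; rewrite !quot_addE addrA.
Qed.

Lemma quot_addC : commutative quot_add.
Proof. by move=> p q; rewrite /quot_add addrC. Qed.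

Lemma quot_add0 : left_id quot_zero quot_add.
Proof. by move=> p; case: (quot_pi_surj p) => x ->; rewrite quot_addE add0r. Qed.

HB.instance Definition _ := GRing.isNmodule.Build quot
  quot_addA quot_addC quot_add0.

Lemma quot_piD x y : quot_pi (x + y) = quot_pi x + quot_pi y.
Proof. by rewrite -[RHS]/(quot_add _ _) quot_addE. Qed.

Lemma quot_scaleA a b p : quot_scale a (quot_scale b p) = quot_scale (a * b) p.
Proof. by case: (quot_pi_surj p) => x ->; rewrite !quot_scaleE scalerA. Qed.

Lemma quot_scale0 p : quot_scale 0 p = 0.
Proof. by case: (quot_pi_surj p) => x ->; rewrite quot_scaleE scale0r. Qed.

Lemma quot_scale1 : left_id 1 quot_scale.
Proof. by move=> p; case: (quot_pi_surj p) => x ->; rewrite quot_scaleE scale1r. Qed.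

Lemma quot_scaleDr : right_distributive quot_scale +%R.
Proof.
move=> a p q; case: (quot_pi_surj p) (quot_pi_surj q) => x -> [y ->].
by rewrite -quot_piD !quot_scaleE -quot_piD scalerDr.
Qed.

Lemma quot_scaleDl p : {morph quot_scale^~ p : a b / a + b}.
Proof.
move=> a b; case: (quot_pi_surj p) => x ->.
by rewrite !quot_scaleE -quot_piD scalerDl.
Qed.

HB.instance Definition _ := GRing.Nmodule_isLSemiModule.Build boolsr quot
  quot_scaleA quot_scale0 quot_scale1 quot_scaleDr quot_scaleDl.

Lemma quot_actM p s t : quot_act p (s * t)%g = quot_act (quot_act p s) t.
Proof. by case: (quot_pi_surj p) => x ->; rewrite !quot_actE rmactM. Qed.

Lemma quot_actD p q s : quot_act (p + q) s = quot_act p s + quot_act q s.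
Proof.
case: (quot_pi_surj p) (quot_pi_surj q) => x -> [y ->].
by rewrite -quot_piD !quot_actE -quot_piD rmactD.
Qed.

Lemma quot_act0 s : quot_act 0 s = 0.
Proof. by rewrite -[0 in LHS]/(quot_pi 0) quot_actE rmact0. Qed.

Lemma quot_act_unitary (e : salg S) : salg_identity e ->
  forall p, \sum_(s : S) e s *: quot_act p s = p.
Proof.
move=> e1 p; case: (quot_pi_surj p) => x ->.
rewrite -[in RHS](rmact_unitary _ e1 x) [RHS](big_morph _ quot_piD erefl).
by apply: eq_bigr => s _; rewrite quot_actE -[LHS]/(quot_scale _ _) quot_scaleE.
Qed.

HB.instance Definition _ := isRightModule.Build S quot
  quot_actM quot_actD quot_act0 quot_act_unitary.

End Quotient.

Section Green.
Variable S : finSemigroupType.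
Implicit Types s t x y : S.

(* [option S] stands for S^1, with [None] the adjoined identity. *)
Definition adjl (u : option S) s : S := if u is Some v then (v * s)%g else s.
Definition adjr s (u : option S) : S := if u is Some v then (s * v)%g else s.

Definition plideal s : {set S} := [set adjl u s | u : option S].
Definition prideal s : {set S} := [set adjr s u | u : option S].
Definition pideal s : {set S} :=
  [set adjr (adjl u s) v | u : option S, v : option S].

Definition Jcls s : {set S} := [set t | pideal s == pideal t].
Definition Rcls s : {set S} := [set t | prideal s == prideal t].
Definition Lcls s : {set S} := [set t | plideal s == plideal t].

Record jclass := JClass {
  jset :> {set S};
  jsetP : exists x, jset = Jcls x
}.

Definition regular_jclass (J : jclass) : Prop := exists2 e, e \in J & (e * e)%g = e.

Lemma adjlA u x y : (adjl u x * y)%g = adjl u (x * y)%g.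
Proof. by case: u => //= v; rewrite mulgA. Qed.

Lemma adjrA u x y : (x * adjr y u)%g = adjr (x * y)%g u.
Proof. by case: u => //= v; rewrite mulgA. Qed.

Lemma adjlr1 u v x : adjr (adjl u x) v = adjl u (adjr x v).
Proof. by case: u v => [u|] [v|] //=; rewrite mulgA. Qed.

Lemma adjl_comp (u v : option S) x : exists w, adjl u (adjl v x) = adjl w x.
Proof.
case: u v => [u|] [v|]; [exists (Some (u * v)%g) | exists (Some u) |
  exists (Some v) | exists None] => //=; by rewrite mulgA.
Qed.

Lemma adjr_comp (u v : option S) x : exists w, adjr (adjr x u) v = adjr x w.
Proof.
case: u v => [u|] [v|]; [exists (Some (u * v)%g) | exists (Some u) |
  exists (Some v) | exists None] => //=; by rewrite mulgA.
Qed.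

Lemma mem_lideal x : x \in plideal x.
Proof. by apply/imsetP; exists None. Qed.

Lemma mem_rideal x : x \in prideal x.
Proof. by apply/imsetP; exists None. Qed.

Lemma mem_ideal x : x \in pideal x.
Proof. by apply/imset2P; exists None None. Qed.

Lemma ideal_sub x y : x \in pideal y -> pideal x \subset pideal y.
Proof.
case/imset2P => u v _ _ ->; apply/subsetP => z /imset2P[u' v' _ _ ->].
rewrite -!adjlr1; have [w ->] := adjr_comp v v' (adjl u' (adjl u y)).
by have [w' ->] := adjl_comp u' u y; apply/imset2P; exists w' w.
Qed.

Lemma ideal_eq x y : x \in pideal y -> y \in pideal x -> pideal x = pideal y.
Proof.
by move=> xy yx; apply/eqP; rewrite eqEsubset !ideal_sub.
Qed.

Lemma lideal_ideal x y : plideal x = plideal y -> pideal x = pideal y.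
Proof.
have sub a b : a \in plideal b -> a \in pideal b.
  by case/imsetP => u _ ->; apply/imset2P; exists u None.
by move=> xy; apply: ideal_eq; apply: sub; rewrite ?xy ?mem_lideal // -xy mem_lideal.
Qed.

Lemma rideal_ideal x y : prideal x = prideal y -> pideal x = pideal y.
Proof.
have sub a b : a \in prideal b -> a \in pideal b.
  by case/imsetP => u _ ->; apply/imset2P; exists None u.
by move=> xy; apply: ideal_eq; apply: sub; rewrite ?xy ?mem_rideal // -xy mem_rideal.
Qed.

Lemma lidealM x y s : plideal x = plideal y -> plideal (x * s)%g = plideal (y * s)%g.
Proof.
have E z : plideal (z * s)%g = [set (w * s)%g | w in plideal z].
  by rewrite /plideal -imset_comp; apply: eq_imset => u /=; rewrite adjlA.
by move=> xy; rewrite !E xy.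
Qed.

Lemma ridealM x y s : prideal x = prideal y -> prideal (s * x)%g = prideal (s * y)%g.
Proof.
have E z : prideal (s * z)%g = [set (s * w)%g | w in prideal z].
  by rewrite /prideal -imset_comp; apply: eq_imset => u /=; rewrite adjrA.
by move=> xy; rewrite !E xy.
Qed.

Lemma memLcls x : x \in Lcls x. Proof. by rewrite inE. Qed.

Lemma memRcls x : x \in Rcls x. Proof. by rewrite inE. Qed.

Lemma LclsP x y : reflect (Lcls x = Lcls y) (plideal x == plideal y).
Proof.
apply: (iffP eqP) => [xy|xy]; first by apply/setP => z; rewrite !inE xy.
by have := memLcls y; rewrite -xy inE => /eqP.
Qed.

Lemma RclsP x y : reflect (Rcls x = Rcls y) (prideal x == prideal y).
Proof.
apply: (iffP eqP) => [xy|xy]; first by apply/setP => z; rewrite !inE xy.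
by have := memRcls y; rewrite -xy inE => /eqP.
Qed.

Lemma LclsM x y s : Lcls x = Lcls y -> Lcls (x * s)%g = Lcls (y * s)%g.
Proof. by move/LclsP/eqP => xy; apply/LclsP/eqP/lidealM. Qed.

Lemma RclsM x y s : Rcls x = Rcls y -> Rcls (s * x)%g = Rcls (s * y)%g.
Proof. by move/RclsP/eqP => xy; apply/RclsP/eqP/ridealM. Qed.

Variable J : jclass.

Lemma mem_jclass x y : x \in J -> (y \in J) = (pideal x == pideal y).
Proof. by case: (jsetP J) => z ->; rewrite !inE => /eqP ->. Qed.

Lemma jclass_Lcls x y : Lcls x = Lcls y -> (x \in J) = (y \in J).
Proof.
move/LclsP/eqP/lideal_ideal => xy.
by case: (jsetP J) => z ->; rewrite !inE xy.
Qed.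

Lemma jclass_Rcls x y : Rcls x = Rcls y -> (x \in J) = (y \in J).
Proof.
move/RclsP/eqP/rideal_ideal => xy.
by case: (jsetP J) => z ->; rewrite !inE xy.
Qed.

Lemma jclassMl x s t : x \in J -> (x * s * t)%g \in J -> (x * s)%g \in J.
Proof.
move=> xJ; rewrite !(mem_jclass _ xJ) => /eqP xst; apply/eqP/ideal_eq.
  have: x \in pideal (x * s * t)%g by rewrite -xst mem_ideal.
  apply/subsetP/ideal_sub; apply/imset2P; exists None (Some t) => //.
by apply/imset2P; exists None (Some s).
Qed.

Lemma jclassMr x s t : x \in J -> (s * (t * x))%g \in J -> (t * x)%g \in J.
Proof.
move=> xJ; rewrite !(mem_jclass _ xJ) => /eqP xst; apply/eqP/ideal_eq.
  have: x \in pideal (s * (t * x))%g by rewrite -xst mem_ideal.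
  apply/subsetP/ideal_sub; apply/imset2P; exists (Some s) None => //.
by apply/imset2P; exists (Some t) None.
Qed.

End Green.

Section JClassModules.
Variables (S : finSemigroupType) (J : jclass S).

Definition Lclasses : {set {set S}} := [set Lcls x | x in J].
Definition Rclasses : {set {set S}} := [set Rcls x | x in J].

Definition Lset : Type := {b : {set S} | b \in Lclasses}.
Definition Rset : Type := {a : {set S} | a \in Rclasses}.
HB.instance Definition _ := Finite.on Lset.
HB.instance Definition _ := SubFinite.on Lset.
HB.instance Definition _ := Finite.on Rset.
HB.instance Definition _ := SubFinite.on Rset.

Fact lrep_subproof (b : Lset) : exists x, (x \in J) && (Lcls x == val b).
Proof. by have /imsetP[x xJ xc] := valP b; exists x; rewrite xJ xc /=. Qed.
Definition lrep (b : Lset) : S := xchoose (lrep_subproof b).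

Fact rrep_subproof (a : Rset) : exists x, (x \in J) && (Rcls x == val a).
Proof. by have /imsetP[x xJ xc] := valP a; exists x; rewrite xJ xc /=. Qed.
Definition rrep (a : Rset) : S := xchoose (rrep_subproof a).

Lemma lrepP b : lrep b \in J /\ Lcls (lrep b) = val b.
Proof. by have /andP[? /eqP] := xchooseP (lrep_subproof b). Qed.

Lemma rrepP a : rrep a \in J /\ Rcls (rrep a) = val a.
Proof. by have /andP[? /eqP] := xchooseP (rrep_subproof a). Qed.

Definition freeL : Type := {ffun Lset -> boolsr^o}.
HB.instance Definition _ := Finite.on freeL.
HB.instance Definition _ := GRing.LSemiModule.on freeL.

(* The basis vector of the L-class of x, meaningful for x in J only. *)
Definition lbasis (x : S) : freeL := [ffun b : Lset => BoolSR (val b == Lcls x)].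

(* The value does not depend on the representatives [lrep b], see [freeL_actE]. *)
Definition freeL_act (m : freeL) (s : S) : freeL :=
  \sum_(b : Lset) m b *:
    (if (lrep b * s)%g \in J then lbasis (lrep b * s)%g else 0).

Lemma freeL_actE x s : x \in J ->
  freeL_act (lbasis x) s = if (x * s)%g \in J then lbasis (x * s)%g else 0.
Proof.
move=> xJ; have xL : Lcls x \in Lclasses by apply/imsetP; exists x.
pose b : Lset := Sub (Lcls x) xL.
rewrite /freeL_act (bigD1 b) //= big1 ?addr0; last first.
  move=> c cb; rewrite ffunE scale_boolsr /=.
  case: eqP => // cx; case/eqP: cb; apply: val_inj.
  by rewrite SubK.
rewrite ffunE scale_boolsr /= eqxx.
have bx : Lcls (lrep b * s)%g = Lcls (x * s)%g.
  by apply: LclsM; have [_ ->] := lrepP b; rewrite SubK.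
rewrite (jclass_Lcls _ bx); case: ifP => // _.
by apply/ffunP => c; rewrite !ffunE bx.
Qed.

Lemma lbasisE x y : Lcls x = Lcls y -> lbasis x = lbasis y.
Proof. by move=> xy; apply/ffunP => b; rewrite !ffunE xy. Qed.

Lemma freeL_decomp (m : freeL) : m = \sum_(b : Lset) m b *: lbasis (lrep b).
Proof.
apply/ffunP => c; rewrite sum_ffunE (bigD1 c) //= big1 ?addr0.
  rewrite !ffunE; have [_ ->] := lrepP c; rewrite eqxx.
  by rewrite scale_boolsr; case: (m c) => -[].
move=> b bc; rewrite !ffunE; have [_ ->] := lrepP b.
rewrite (inj_eq val_inj) eq_sym (negPf bc).
by rewrite scale_boolsr; case: (m b) => -[].
Qed.

Lemma freeL_actD m n s : freeL_act (m + n) s = freeL_act m s + freeL_act n s.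
Proof.
by rewrite -big_split; apply: eq_bigr => b _; rewrite ffunE scalerDl.
Qed.

Lemma freeL_act0 s : freeL_act 0 s = 0.
Proof. by rewrite /freeL_act big1 // => b _; rewrite ffunE scale0r. Qed.

Lemma freeL_actZ a m s : freeL_act (a *: m) s = a *: freeL_act m s.
Proof.
by rewrite scaler_sumr; apply: eq_bigr => b _; rewrite ffunE scalerA.
Qed.

Lemma freeL_act_sum (F : Lset -> freeL) s :
  freeL_act (\sum_b F b) s = \sum_b freeL_act (F b) s.
Proof.
by apply: (big_morph (freeL_act^~ s)) => [m n|]; rewrite ?freeL_actD ?freeL_act0.
Qed.

Lemma freeL_act_decomp m s :
  freeL_act m s = \sum_(b : Lset) m b *: freeL_act (lbasis (lrep b)) s.
Proof.
rewrite [in LHS](freeL_decomp m) freeL_act_sum.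
by apply: eq_bigr => b _; rewrite freeL_actZ.
Qed.

Lemma freeL_actM m s t :
  freeL_act m (s * t)%g = freeL_act (freeL_act m s) t.
Proof.
rewrite !(freeL_act_decomp m) freeL_act_sum; apply: eq_bigr => b _.
rewrite freeL_actZ; congr (_ *: _); have [bJ _] := lrepP b.
rewrite !freeL_actE // mulgA; case: ifPn => [xsJ|xsJ].
  have xs := jclassMl bJ xsJ.
  by rewrite xs freeL_actE // xsJ.
case: ifPn => xs; last by rewrite freeL_act0.
by rewrite freeL_actE // (negPf xsJ).
Qed.

Lemma freeL_act_unitary (e : salg S) : salg_identity e ->
  forall m, \sum_(s : S) e s *: freeL_act m s = m.
Proof.
apply: unitary_of_identity => [noS m|t t1 m].
  by apply/ffunP => b; case: (noS (lrep b)).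
rewrite [RHS]freeL_decomp freeL_act_decomp; apply: eq_bigr => b _.
have [bJ _] := lrepP b; rewrite freeL_actE //.
by have [_ ->] := t1 (lrep b); rewrite bJ.
Qed.

HB.instance Definition _ := isRightModule.Build S freeL
  freeL_actM freeL_actD freeL_act0 freeL_act_unitary.

Definition apex_rel (m n : freeL) : Prop :=
  forall s : S, rmact m s = 0 <-> rmact n s = 0.

Lemma apex_refl m : apex_rel m m. Proof. by []. Qed.

Lemma apex_sym m n : apex_rel m n -> apex_rel n m.
Proof. by move=> mn s; split=> /mn. Qed.

Lemma apex_trans m n p : apex_rel m n -> apex_rel n p -> apex_rel m p.
Proof. by move=> mn np s; split=> [/mn/np|/np/mn]. Qed.

Lemma apexD m n m' n' :
  apex_rel m n -> apex_rel m' n' -> apex_rel (m + m') (n + n').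
Proof.
move=> mn mn' s; rewrite !rmactD.
by split=> /addx_eq0 [] => [/mn a /mn' b|/mn a /mn' b]; apply/addx_eq0.
Qed.

Lemma apex_act m n s : apex_rel m n -> apex_rel (rmact m s) (rmact n s).
Proof. by move=> mn t; rewrite -!rmactM; exact: mn. Qed.

Definition apex_cong : congruence freeL :=
  Congruence apex_refl apex_sym apex_trans apexD apex_act.

Definition Cmat (b : Lset) (a : Rset) : boolsr :=
  BoolSR [exists e in val a :&: val b, (e * e)%g == e].

(* Vectors indexed by the set A of R-classes in J, as the right module dual to
   the left action of S on A: (f s)(a) = f (s a), read as 0 if s a falls out of
   J.  The rows of [Cmat] are elements of this module.  In [coR_act], at most
   one R-class [a'] in J contains the product, and none does if the product is
   not in J. *)
Definition coR : Type := {ffun Rset -> boolsr^o}.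
HB.instance Definition _ := Finite.on coR.
HB.instance Definition _ := GRing.LSemiModule.on coR.

Definition coR_act (f : coR) (s : S) : coR :=
  [ffun a => \sum_(a' : Rset | (s * rrep a)%g \in val a') f a'].

Lemma Rset_mem (a : Rset) x : (x \in val a) = (val a == Rcls x).
Proof.
have [_ <-] := rrepP a; rewrite inE; apply/eqP/eqP => [/eqP/RclsP //|].
by move/RclsP/eqP.
Qed.

Lemma Rset_sub (a : Rset) x : x \in val a -> x \in J.
Proof.
rewrite Rset_mem => /eqP ax; have [aJ ar] := rrepP a.
by rewrite (@jclass_Rcls _ J x (rrep a)) // -ax.
Qed.

Lemma coR_actE (f : coR) s (a : Rset) x : x \in val a ->
  coR_act f s a = \sum_(a' : Rset | (s * x)%g \in val a') f a'.
Proof.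
move=> xa; rewrite ffunE; apply: eq_bigl => a'; rewrite !Rset_mem.
have -> // : Rcls (s * rrep a)%g = Rcls (s * x)%g.
by apply: RclsM; have [_ ->] := rrepP a; apply/eqP; rewrite -Rset_mem.
Qed.

Lemma coR_actM f s t : coR_act f (s * t)%g = coR_act (coR_act f s) t.
Proof.
apply/ffunP => a; rewrite [RHS]ffunE [LHS]ffunE; have [aJ _] := rrepP a.
case: (boolP ((t * rrep a)%g \in J)) => taJ; last first.
  rewrite !big_pred0 // => a'; apply: contraNF taJ => /Rset_sub //.
  by rewrite -mulgA => /(jclassMr aJ).
have taR : Rcls (t * rrep a)%g \in Rclasses by apply/imsetP; exists (t * rrep a)%g.
pose c : Rset := Sub (Rcls (t * rrep a)%g) taR.
rewrite [RHS](eq_bigl (pred1 c)); last first.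
  by move=> a'; rewrite Rset_mem /= -(inj_eq val_inj).
rewrite big_pred1_eq.
by rewrite (@coR_actE f s c (t * rrep a)%g) ?mulgA //= memRcls.
Qed.

Lemma coR_actD f g s : coR_act (f + g) s = coR_act f s + coR_act g s.
Proof.
apply/ffunP => a; rewrite !ffunE -big_split.
by apply: eq_bigr => a' _; rewrite ffunE.
Qed.

Lemma coR_act0 s : coR_act 0 s = 0.
Proof. by apply/ffunP => a; rewrite !ffunE big1 // => a' _; rewrite ffunE. Qed.

Lemma coR_act_unitary (e : salg S) : salg_identity e ->
  forall f, \sum_(s : S) e s *: coR_act f s = f.
Proof.
apply: unitary_of_identity => [noS f|t t1 f].
  by apply/ffunP => a; case: (noS (rrep a)).
apply/ffunP => a; rewrite ffunE (eq_bigl (pred1 a)) ?big_pred1_eq // => a'.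
have [-> _] := t1 (rrep a); rewrite Rset_mem; have [_ ->] := rrepP a.
by rewrite (inj_eq val_inj).
Qed.

HB.instance Definition _ := isRightModule.Build S coR
  coR_actM coR_actD coR_act0 coR_act_unitary.

Definition Crow (b : Lset) : coR := [ffun a => Cmat b a].

Definition row_span (f : coR) : Prop :=
  exists c : Lset -> boolsr, f = \sum_(b : Lset) c b *: Crow b.

End JClassModules.

(* Main.v *)
Require Import Defs.
From HB Require Import structures.
From mathcomp Require Import all_boot ssralg.

Import GRing.Theory.
Local Open Scope ring_scope.

Set Implicit Arguments.
Unset Strict Implicit.
Unset Printing Implicit Defensive.

(** Everything rests on two facts about products in a J-class J of a finite
semigroup.  Stability ([Lcls_mul], [Rcls_mul]): a product that stays in J keeps
the L-class of its right factor and the R-class of its left factor.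
Clifford-Miller ([mul_jclassP]): for x, y in J, the product xy stays in J
exactly when the H-class where the L-class of x meets the R-class of y contains
an idempotent.

Let J be regular.  Then S moves any basis vector of the free module on the
L-classes to any other ([lbasis_trans]), so a congruence that identifies one
basis vector with 0 identifies everything with 0 ([cong0_total]).  If a
congruence relates m and n with ms = 0 and ns <> 0, it relates 0 to ns, hence,
addition being idempotent, to every basis vector below ns.  So every proper
congruence is contained in the apex congruence ([proper_le_apex]), which is
therefore the largest one.  Minimality comes from stability: if s is in J, then
ms is 0 or the basis vector of s ([rmact_in_jclass]), so a nonzero submodule
contains a basis vector, hence all of them.

Evaluating m at an R-class a by asking whether m does not vanish on elements of
a gives an equivariant map to vectors indexed by R-classes.  By Clifford-Miller
it sends a basis vector to a row of the matrix C, and its kernel is the apex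
congruence ([ker_row_map]); this identifies the quotient with the span of the
rows.

Conversely, a minimal module M has a largest element w ([minimal_top]).
Choose s with ws <> 0 generating a smallest possible ideal, and let J be its
J-class.  If x = uy, then wx = (wu)y <= wy, so wx depends only on the L-class of
x, and the L-class of x in J is sent to wx by a well defined homomorphism.  It is
onto because M is minimal, and J must be regular because w is in the image and
is not annihilated by J ([minimal_cover]).  So M is the quotient by the kernel
of this map, and if M is also simple, the kernel is the apex congruence. *)

(** * Stability and regularity of J-classes in a finite semigroup *)

Section Semigroup.
Variable S : finSemigroupType.
Implicit Types (x y z s t e : S) (J : jclass S).

Lemma lideal_sub x y : x \in plideal y -> plideal x \subset plideal y.
Proof.
case/imsetP => u _ ->; apply/subsetP => z /imsetP[v _ ->].
by have [w ->] := adjl_comp v u y; apply/imsetP; exists w.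
Qed.

Lemma rideal_sub x y : x \in prideal y -> prideal x \subset prideal y.
Proof.
case/imsetP => u _ ->; apply/subsetP => z /imsetP[v _ ->].
by have [w ->] := adjr_comp u v y; apply/imsetP; exists w.
Qed.

Lemma Lcls_eq x y : x \in plideal y -> y \in plideal x -> Lcls x = Lcls y.
Proof.
by move=> xy yx; apply/LclsP; rewrite eqEsubset !lideal_sub.
Qed.

Lemma Rcls_eq x y : x \in prideal y -> y \in prideal x -> Rcls x = Rcls y.
Proof.
by move=> xy yx; apply/RclsP; rewrite eqEsubset !rideal_sub.
Qed.

Lemma Lcls_lideal x y : Lcls x = Lcls y -> x \in plideal y.
Proof. by move/LclsP/eqP <-; exact: mem_lideal. Qed.

Lemma Rcls_rideal x y : Rcls x = Rcls y -> x \in prideal y.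
Proof. by move/RclsP/eqP <-; exact: mem_rideal. Qed.

(** Multiplying the left ideal of y on the left shrinks it, and multiplying it on
the right maps it onto the left ideal of the product; neither increases the
cardinal.  For a finite S this turns inclusions of ideals into equalities. *)
Lemma card_lideal x y : x \in pideal y -> #|plideal x| <= #|plideal y|.
Proof.
case/imset2P => u v _ _ ->.
have le_u : #|plideal (adjl u y)| <= #|plideal y|.
  by apply: subset_leq_card; apply: lideal_sub; apply/imsetP; exists u.
case: v => [v|] //=; apply: leq_trans le_u.
suff -> : plideal (adjl u y * v)%g = [set (w * v)%g | w in plideal (adjl u y)].
  exact: leq_imset_card.
by rewrite /plideal -imset_comp; apply: eq_imset => w /=; rewrite [RHS]adjlA.
Qed.

Lemma card_rideal x y : x \in pideal y -> #|prideal x| <= #|prideal y|.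
Proof.
case/imset2P => u v _ _ ->; rewrite adjlr1.
have le_v : #|prideal (adjr y v)| <= #|prideal y|.
  by apply: subset_leq_card; apply: rideal_sub; apply/imsetP; exists v.
case: u => [u|] //=; apply: leq_trans le_v.
suff -> : prideal (u * adjr y v)%g = [set (u * w)%g | w in prideal (adjr y v)].
  exact: leq_imset_card.
by rewrite /prideal -imset_comp; apply: eq_imset => w /=; rewrite [RHS]adjrA.
Qed.

Lemma stable_lideal x y :
  y \in plideal x -> pideal x = pideal y -> Lcls y = Lcls x.
Proof.
move=> yx xy; apply/LclsP; rewrite eqEcard lideal_sub //.
by apply: card_lideal; rewrite -xy mem_ideal.
Qed.

Lemma stable_rideal x y :
  y \in prideal x -> pideal x = pideal y -> Rcls y = Rcls x.
Proof.
move=> yx xy; apply/RclsP; rewrite eqEcard rideal_sub //.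
by apply: card_rideal; rewrite -xy mem_ideal.
Qed.

Lemma jclass_ideal J x y : x \in J -> y \in J -> pideal x = pideal y.
Proof. by move=> xJ; rewrite (mem_jclass _ xJ) => /eqP. Qed.

(** Stability, in the form in which it is used. *)
Lemma Lcls_mul J x s : x \in J -> (s * x)%g \in J -> Lcls (s * x)%g = Lcls x.
Proof.
move=> xJ sxJ; apply: stable_lideal (jclass_ideal xJ sxJ).
by apply/imsetP; exists (Some s).
Qed.

Lemma Rcls_mul J x s : x \in J -> (x * s)%g \in J -> Rcls (x * s)%g = Rcls x.
Proof.
move=> xJ xsJ; apply: stable_rideal (jclass_ideal xJ xsJ).
by apply/imsetP; exists (Some s).
Qed.

(** The Clifford-Miller lemma.  If xy stays in J, stability gives u and v with
y = uxy and x = xyv; then ux = uxyv = yv is an idempotent, a right identity of x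
and a left identity of y.  Conversely, if e is such an idempotent, then
xy is L-related to ey = y. *)
Lemma mul_jclassP J x y : x \in J -> y \in J ->
  (x * y)%g \in J <->
  exists2 e, (e * e)%g = e & Lcls e = Lcls x /\ Rcls e = Rcls y.
Proof.
move=> xJ yJ; split=> [xyJ|[e ee [ex ey]]]; last first.
  have /imsetP[u _ xE] := Lcls_lideal (esym ex).
  have /imsetP[v _ yE] := Rcls_rideal (esym ey).
  have e_y : (e * y)%g = y by rewrite yE adjrA ee.
  by rewrite (@jclass_Lcls _ _ _ y) // -[in RHS]e_y; exact/LclsM/esym.
have /imsetP[u _ yE] := Lcls_lideal (esym (Lcls_mul yJ xyJ)).
have /imsetP[v _ xE] := Rcls_rideal (esym (Rcls_mul xJ xyJ)).
have eE : adjr y v = adjl u x by rewrite {1}yE adjlr1 -xE.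
have xe : (x * adjl u x)%g = x by rewrite -eE adjrA -xE.
have ey : (adjl u x * y)%g = y by rewrite adjlA -yE.
exists (adjl u x); first by rewrite adjlA xe.
split.
  apply: Lcls_eq; first by apply/imsetP; exists u.
  by apply/imsetP; exists (Some x).
apply: Rcls_eq; first by apply/imsetP; exists v.
by apply/imsetP; exists (Some y).
Qed.

(** Because e = ee, the factor can be taken in S instead of S^1. *)
Lemma idem_lfactor e x : (e * e)%g = e -> e \in plideal x -> exists s, e = (s * x)%g.
Proof.
move=> ee /imsetP[[s|] _ /= eE]; first by exists s.
by exists e; rewrite -eE.
Qed.

Lemma idem_rfactor e x : (e * e)%g = e -> e \in prideal x -> exists s, e = (x * s)%g.
Proof.
move=> ee /imsetP[[s|] _ /= eE]; first by exists s.
by exists e; rewrite -eE.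
Qed.

(** Elements of a regular J-class are von Neumann regular.  If e is an idempotent
of J and x = uev, then x = wy with w = ue and y = ev; by stability w is L-related
and y is R-related to e, so that e = r'w = yr, and x(rr')x = w(yr)(r'w)y = wy = x. *)
Lemma regular_mul J x :
  regular_jclass J -> x \in J -> exists z, (x * z * x)%g = x.
Proof.
move=> [e eJ ee] xJ.
have xe := jclass_ideal xJ eJ.
have /imset2P[u v _ _ xE] : x \in pideal e by rewrite -xe mem_ideal.
have wI : adjl u e \in pideal e by apply/imset2P; exists u None.
have yI : adjr e v \in pideal e by apply/imset2P; exists None v.
have xwI : x \in pideal (adjl u e) by apply/imset2P; exists None v.
have xyI : x \in pideal (adjr e v).
  by apply/imset2P; exists u None => //=; rewrite -adjlr1.
have [|r' er'] := @idem_lfactor e (adjl u e) ee.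
  apply/Lcls_lideal/esym; apply: stable_lideal; first by apply/imsetP; exists u.
  by apply: ideal_eq => //; apply: subsetP (ideal_sub xwI) _ _; rewrite xe mem_ideal.
have [|r er] := @idem_rfactor e (adjr e v) ee.
  apply/Rcls_rideal/esym; apply: stable_rideal; first by apply/imsetP; exists v.
  by apply: ideal_eq => //; apply: subsetP (ideal_sub xyI) _ _; rewrite xe mem_ideal.
have xwy : x = (adjl u e * adjr e v)%g by rewrite adjrA adjlA ee.
exists (r * r')%g; rewrite {1 2}xwy.
transitivity
    (adjl u e * (adjr e v * r) * (r' * adjl u e) * adjr e v)%g.
  by rewrite !mulgA.
by rewrite -er -er' -!mulgA adjrA ee adjrA ee -xwy.
Qed.

End Semigroup.

(** * Homomorphisms, congruences and quotients of modules *)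

Section Modules.
Variable S : finSemigroupType.
Implicit Types M N : rmodType S.

(** Scalars are 0 or 1, so additivity already gives linearity. *)
Lemma linear_of_additive (U V : lSemiModType boolsr) (g : U -> V) :
  g 0 = 0 -> {morph g : x y / x + y} -> exists f : {linear U -> V}, f =1 g.
Proof.
move=> g0 gD.
have gZ : scalable g by move=> a x; rewrite !scale_boolsr; case: ifP.
pose f : {linear U -> V} :=
  HB.pack g (GRing.isSemilinear.Build boolsr U V *:%R g (conj gZ gD)).
by exists f.
Qed.

Lemma nonzero_actionP M :
  nonzero_action M <-> exists (m : M) (s : S), rmact m s <> 0.
Proof.
split=> [[m [f mf]]|[m [s ms]]].
  case: (pickP (fun s => rmact m s != 0)) => [s /eqP ms|m0]; first by exists m, s.
  case: mf; rewrite /salg_act big1 // => s _.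
  by have /negbFE/eqP -> := m0 s; rewrite scaler0.
exists m, [ffun u => BoolSR (u == s)]; rewrite /salg_act (bigD1 s) //=.
rewrite ffunE scale_boolsr eqxx /= big1 ?addr0 // => t ts.
by rewrite ffunE scale_boolsr /= (negPf ts).
Qed.

Lemma sum_eq0 (M : lSemiModType boolsr) (I : finType) (F : I -> M) i :
  \sum_j F j = 0 -> F i = 0.
Proof. by rewrite (bigD1 i) //= => /addx_eq0[]. Qed.

Lemma rmact_sum M (I : finType) (F : I -> M) s :
  rmact (\sum_i F i) s = \sum_i rmact (F i) s.
Proof.
by apply: (big_morph (fun m => rmact m s)) => [m n|]; rewrite ?rmactD ?rmact0.
Qed.

Section Homomorphism.
Variables (M N : rmodType S) (f : {linear M -> N}).
Hypothesis f_act : equivariant f.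
Hypothesis f_surj : forall y, exists x, f x = y.

Lemma ker_cong : exists E : congruence M, forall x y, E x y <-> f x = f y.
Proof.
unshelve eexists.
  apply: (@Congruence _ _ (fun x y => f x = f y)) => //.
  - by move=> x y z -> ->.
  - by move=> x y x' y' xy xy'; rewrite !linearD xy xy'.
  - by move=> x y s xy; rewrite !f_act xy.
by [].
Qed.

Lemma comap_cong (F : congruence N) :
  exists E : congruence M, forall x y, E x y <-> F (f x) (f y).
Proof.
unshelve eexists.
  apply: (@Congruence _ _ (fun x y => F (f x) (f y))).
  - by move=> x; exact: cong_refl.
  - by move=> x y; exact: cong_sym.
  - by move=> x y z; exact: cong_trans.
  - by move=> x y x' y' xy xy'; rewrite !linearD; exact: congD.
  - by move=> x y s xy; rewrite !f_act; exact: cong_rmact.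
by [].
Qed.

Lemma image_cong (E : congruence M) :
  (forall x y, f x = f y -> E x y) ->
  exists F : congruence N, forall x y, F (f x) (f y) <-> E x y.
Proof.
move=> kerE; unshelve eexists.
  apply: (@Congruence _ _ (fun a b => exists x y, [/\ f x = a, f y = b & E x y])).
  - by move=> a; have [x xa] := f_surj a; exists x, x; split=> //; exact: cong_refl.
  - by move=> a b [x [y [xa yb xy]]]; exists y, x; split=> //; exact: cong_sym.
  - move=> a b c [x [y [xa yb xy]]] [y' [z [yb' zc yz]]].
    exists x, z; split=> //; apply: cong_trans xy (cong_trans _ yz).
    by apply: kerE; rewrite yb.
  - move=> a b a' b' [x [y [xa yb xy]]] [x' [y' [xa' yb' xy']]].
    exists (x + x'), (y + y'); rewrite !linearD xa yb xa' yb'.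
    by split=> //; exact: congD.
  - move=> a b s [x [y [xa yb xy]]]; exists (rmact x s), (rmact y s).
    by rewrite !f_act xa yb; split=> //; exact: cong_rmact.
move=> x y; split=> [[x' [y' [xx yy xy]]]|xy]; last by exists x, y.
by apply: cong_trans (kerE _ _ (esym xx)) (cong_trans xy (kerE _ _ yy)).
Qed.

Lemma ker_proper (E : congruence M) :
  nonzero_action N -> (forall x y, E x y <-> f x = f y) -> proper_cong E.
Proof.
move=> /nonzero_actionP[m [s ms]] kerE.
have [x fx] := f_surj (rmact m s).
by exists x, 0; rewrite kerE fx linear0.
Qed.

Lemma minimal_image : minimal_module M -> nonzero_action N -> minimal_module N.
Proof.
move=> [_ minM] nzN; split=> // P.
have pD x y : P (f x) -> P (f y) -> P (f (x + y)).
  by rewrite linearD; exact: submodD.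
have pA x s : P (f x) -> P (f (rmact x s)) by rewrite f_act; exact: submod_act.
have p0 : P (f 0) by rewrite linear0; exact: submod0.
have [P0|P1] := minM (@Submodule _ _ (fun x => P (f x)) p0 pD pA); [left|right].
  move=> y; split=> [|->]; last exact: submod0.
  by have [x <-] := f_surj y => /P0 ->; rewrite linear0.
by move=> y; have [x <-] := f_surj y; exact: P1.
Qed.

(** The congruences of N are those of M that contain the kernel of f.  So if the
kernel is above all proper congruences of M, the only proper one left on N is
equality. *)
Lemma simple_image :
  (forall E : congruence M, proper_cong E -> forall x y, E x y -> f x = f y) ->
  nonzero_action N -> simple_module N.
Proof.
move=> kerM nzN; split=> // F [a [b ab]].
have [E EF] := comap_cong F.
have Eproper : proper_cong E.
  have [[x xa] [y yb]] := (f_surj a, f_surj b).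
  by exists x, y; rewrite EF xa yb.
move=> c d; have [[x <-] [y <-]] := (f_surj c, f_surj d).
by rewrite -EF; exact: kerM.
Qed.

Lemma ker_maximal (E : congruence M) : simple_module N -> proper_cong E ->
  (forall x y, f x = f y -> E x y) -> forall x y, E x y -> f x = f y.
Proof.
move=> [_ simpleN] [x [y xy]] kerE.
have [F FE] := image_cong kerE.
have Ftriv : trivial_cong F by apply: simpleN; exists (f x), (f y); rewrite FE.
by move=> z t; rewrite -FE; exact: Ftriv.
Qed.

End Homomorphism.

Lemma isomorphic_sym M N : isomorphic M N -> isomorphic N M.
Proof.
move=> [f [f_act [g fK gK]]].
have [||h hg] := @linear_of_additive N M g.
- by rewrite -[0 in LHS](linear0 f) fK.
- by move=> x y; rewrite -[in LHS](gK x) -[in LHS](gK y) -linearD fK.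
exists h; split; last by exists f => x; rewrite hg ?fK ?gK.
by move=> x s; rewrite !hg -[in LHS](gK x) -f_act fK.
Qed.

Lemma quot_rmact M (E : congruence M) x s :
  rmact (quot_pi E x) s = quot_pi E (rmact x s).
Proof. exact: quot_actE. Qed.

Lemma quot_pi_linear M (E : congruence M) :
  exists p : {linear M -> quot E}, p =1 quot_pi E.
Proof. by apply: linear_of_additive => // x y; exact: quot_piD. Qed.

(** Only the injectivity of the induced map is claimed, so that this serves for
isomorphisms as well as for embeddings. *)
Lemma quot_lift M N (f : {linear M -> N}) (E : congruence M) :
  equivariant f -> (forall x y, E x y <-> f x = f y) ->
  exists h : {linear quot E -> N},
    [/\ equivariant h, injective h & forall x, h (quot_pi E x) = f x].
Proof.
move=> f_act kerE.
have gE x : f (repr (quot_pi E x)) = f x by apply/kerE; exact: repr_piP.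
have [||h hg] := @linear_of_additive (quot E) N (fun q => f (repr q)).
- by rewrite gE linear0.
- move=> p q; case: (quot_pi_surj p) (quot_pi_surj q) => x -> [y ->].
  by rewrite -quot_piD !gE linearD.
have hE x : h (quot_pi E x) = f x by rewrite hg gE.
exists h; split=> // [p s|p q].
  by have [x ->] := quot_pi_surj p; rewrite quot_rmact !hE f_act.
case: (quot_pi_surj p) (quot_pi_surj q) => x -> [y ->].
by rewrite !hE => xy; apply/quot_piP/kerE.
Qed.

Lemma first_isomorphism M N (f : {linear M -> N}) (E : congruence M) :
  equivariant f -> (forall y, exists x, f x = y) ->
  (forall x y, E x y <-> f x = f y) -> isomorphic N (quot E).
Proof.
move=> f_act f_surj kerE; apply: isomorphic_sym.
have [h [h_act h_inj hE]] := quot_lift f_act kerE.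
have h_surj y : exists q, h q == y.
  by have [x <-] := f_surj y; exists (quot_pi E x); rewrite hE.
exists h; split=> //; exists (fun y => xchoose (h_surj y)) => [q|y].
  by apply: h_inj; exact/eqP/(xchooseP (h_surj (h q))).
exact/eqP/(xchooseP (h_surj y)).
Qed.

Lemma isomorphic_surj M N : isomorphic M N ->
  exists f : {linear N -> M},
    [/\ equivariant f, injective f & forall y, exists x, f x = y].
Proof.
move/isomorphic_sym => [f [f_act [g fK gK]]]; exists f.
by split=> [//||y]; [exact: can_inj fK | exists (g y)].
Qed.

Lemma nonzero_action_image M N (f : {linear M -> N}) :
  equivariant f -> injective f -> nonzero_action M -> nonzero_action N.
Proof.
move=> f_act f_inj /nonzero_actionP[m [s ms]].
apply/nonzero_actionP; exists (f m), s; rewrite -f_act => fms.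
by apply/ms/f_inj; rewrite fms linear0.
Qed.

Lemma minimal_isomorphic M N : isomorphic M N -> minimal_module N -> minimal_module M.
Proof.
move/isomorphic_surj => [f [f_act f_inj f_surj]] minN.
by apply: (minimal_image f_act f_surj minN); apply: nonzero_action_image minN.1.
Qed.

Lemma simple_isomorphic M N : isomorphic M N -> simple_module N -> simple_module M.
Proof.
move/isomorphic_surj => [f [f_act f_inj f_surj]] [nzN simpleN].
apply: (simple_image f_act f_surj); last exact: nonzero_action_image nzN.
by move=> E Ep x y xy; congr (f _); exact: (simpleN E).
Qed.

End Modules.

(** * The free module on the L-classes of a J-class *)

Section FreeModule.
Variables (S : finSemigroupType) (J : jclass S).
Implicit Types (m n : freeL J) (s x y : S).

Lemma lbasis_neq0 x : x \in J -> lbasis J x <> 0.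
Proof.
move=> xJ; have xL : Lcls x \in Lclasses J by apply/imsetP; exists x.
move/ffunP/(_ (Sub (Lcls x) xL))/(congr1 bool_of_boolsr).
by rewrite !ffunE /= eqxx.
Qed.

Lemma freeL_ind (P : freeL J -> Prop) :
  P 0 -> (forall m n, P m -> P n -> P (m + n)) ->
  (forall x, x \in J -> P (lbasis J x)) -> forall m, P m.
Proof.
move=> P0 PD PB m; rewrite (freeL_decomp m).
elim/big_ind: _ => // b _; rewrite scale_boolsr; case: ifP => // _.
by apply: PB; have [] := lrepP b.
Qed.

(** In a join semilattice, b + m = m says that b lies below m. *)
Lemma freeL_support m : m <> 0 -> exists2 b, m b & lbasis J (lrep b) + m = m.
Proof.
move=> m0; case: (pickP (fun b => m b : bool)) => [b mb|mz]; last first.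
  by case: m0; apply/ffunP => b; rewrite ffunE; apply: val_inj; exact: mz.
exists b => //; rewrite (freeL_decomp m) (bigD1 b) //=.
by rewrite scale_boolsr mb addrA addxx.
Qed.

Lemma rmactE m s :
  rmact m s = \sum_b m b *:
    (if (lrep b * s)%g \in J then lbasis J (lrep b * s)%g else 0).
Proof. by []. Qed.

Lemma rmact_lbasis x s : x \in J ->
  rmact (lbasis J x : freeL J) s =
  if (x * s)%g \in J then lbasis J (x * s)%g else 0.
Proof. exact: freeL_actE. Qed.

(** Sums of basis vectors never cancel, so ms is nonzero as soon as s keeps one
L-class of the support of m inside J. *)
Lemma rmact_neq0 m s :
  (rmact m s != 0) = [exists b, m b && ((lrep b * s)%g \in J)].
Proof.
apply/idP/existsP => [/eqP ms|[b /andP[mb bsJ]]].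
  case: (pickP (fun b => m b && ((lrep b * s)%g \in J))) => [b ?|mz]; first by exists b.
  case: ms; rewrite rmactE big1 // => b _; rewrite scale_boolsr.
  by have := mz b; case: (m b : bool) => //= ->.
apply/eqP => /(sum_eq0 b); rewrite scale_boolsr mb bsJ.
exact: lbasis_neq0.
Qed.

(** By stability, every basis vector that s does not kill is sent to the L-class
of s. *)
Lemma rmact_in_jclass m s : s \in J -> rmact m s = 0 \/ rmact m s = lbasis J s.
Proof.
move=> sJ; rewrite rmactE; elim/big_ind: _ => [|x y|b _]; first by left.
  by case=> ->; case=> ->; rewrite ?add0r ?addr0 ?addxx; [left|right..].
rewrite scale_boolsr; case: ifP => _; last by left.
case: ifP => bsJ; [right | by left].
exact/lbasisE/(Lcls_mul sJ bsJ).
Qed.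

Hypothesis regJ : regular_jclass J.

(** Write y = uxv.  Then w = xv is in J and L-related to y.  To reach w from x
inside S even when v is the adjoined identity, use w = x(zxv) with xzx = x. *)
Lemma lbasis_trans x y : x \in J -> y \in J ->
  exists s, rmact (lbasis J x : freeL J) s = lbasis J y.
Proof.
move=> xJ yJ; have xy := jclass_ideal xJ yJ.
have /imset2P[u v _ _ yE] : y \in pideal x by rewrite xy mem_ideal.
have [z xzx] := regular_mul regJ xJ.
have wE : (x * (z * adjr x v))%g = adjr x v by rewrite mulgA adjrA xzx.
have xw : pideal x = pideal (adjr x v).
  apply: ideal_eq; last by apply/imset2P; exists None v.
  have: x \in pideal y by rewrite -xy mem_ideal.
  by apply/subsetP/ideal_sub; rewrite yE adjlr1; apply/imset2P; exists u None.
have wJ : adjr x v \in J by rewrite (mem_jclass _ xJ) xw.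
exists (z * adjr x v)%g; rewrite rmact_lbasis // wE wJ; apply: lbasisE.
apply/esym/stable_lideal; last by rewrite -xw.
by rewrite yE adjlr1; apply/imsetP; exists u.
Qed.

(** If b is in the support of m and bzb = b, then zb is in J and fixes the basis
vector of b. *)
Lemma rmact_neq0_ex m : m <> 0 -> exists2 s, s \in J & rmact m s <> 0.
Proof.
move=> /freeL_support[b mb _]; have [bJ _] := lrepP b.
have [z bzb] := regular_mul regJ bJ; exists (z * lrep b)%g.
  by apply: (@jclassMr _ _ _ (lrep b)); rewrite // mulgA bzb.
by apply/eqP; rewrite rmact_neq0; apply/existsP; exists b; rewrite mb mulgA bzb.
Qed.

Lemma cong0_total (E : congruence (freeL J)) x :
  x \in J -> E (lbasis J x) 0 -> forall m, E m 0.
Proof.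
move=> xJ Ex0; apply: freeL_ind => [|m n m0 n0|y yJ]; first exact: cong_refl.
  by rewrite -[X in E _ X](addr0 (0 : freeL J)); exact: congD.
have [s <-] := lbasis_trans xJ yJ.
have <- : rmact (0 : freeL J) s = 0 by exact: rmact0.
exact: cong_rmact.
Qed.

Lemma apex_proper : proper_cong (apex_cong J).
Proof.
case: regJ => e eJ ee; exists (lbasis J e), 0 => /(_ e)[_].
rewrite rmact_lbasis // rmact0 ee eJ => /(_ erefl).
exact: lbasis_neq0.
Qed.

(** If E relates m and n with ms = 0 and ns <> 0, it relates 0 and ns.  For a
basis vector b below ns, b = b + 0 is related to b + ns = ns, hence to 0, and E
collapses everything. *)
Lemma proper_le_apex (E : congruence (freeL J)) :
  proper_cong E -> cong_le E (apex_cong J).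
Proof.
move=> [p [q Epq]].
suff kill m n s : E m n -> rmact m s = 0 -> rmact n s = 0.
  by move=> m n mn s; split; apply: kill => //; exact: cong_sym.
move=> mn ms; apply/eqP/negP => /negP/eqP ns; apply: Epq.
have [b _ bE] := freeL_support ns; have [bJ _] := lrepP b.
have E0 : E 0 (rmact n s) by rewrite -ms; exact: cong_rmact.
have Eb : E (lbasis J (lrep b)) 0.
  apply: cong_trans (cong_sym E0); rewrite -bE -[X in E X _]addr0.
  by apply: congD => //; exact: cong_refl.
by apply: cong_trans (cong0_total bJ Eb p) (cong_sym (cong0_total bJ Eb q)).
Qed.

Lemma apex_unique_maximal : unique_maximal_proper (apex_cong J).
Proof.
split=> [|F [Fp Fmax]].
  split=> [|F Fp apexF x y]; first exact: apex_proper.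
  by split=> [|xy]; [exact: proper_le_apex | exact: apexF].
have eqF := Fmax _ apex_proper (proper_le_apex Fp).
by move=> x y; rewrite eqF.
Qed.

Lemma freeL_nonzero_action : nonzero_action (freeL J).
Proof.
case: regJ => e eJ ee; apply/nonzero_actionP; exists (lbasis J e), e.
by rewrite rmact_lbasis // ee eJ; exact: lbasis_neq0.
Qed.

(** A nonzero m has ms <> 0 for some s in J, and then ms is a basis vector, from
which the action and sums produce everything. *)
Lemma freeL_minimal : minimal_module (freeL J).
Proof.
split=> [|N]; first exact: freeL_nonzero_action.
case: (boolp.pselect (exists2 m, N m & m <> 0)) => [[m Nm m0]|N0]; last first.
  left=> m; split=> [Nm|->]; last exact: submod0.
  by apply/eqP/negP => /negP/eqP m0; apply: N0; exists m.
right; have [s sJ ms] := rmact_neq0_ex m0.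
have Ns : N (lbasis J s) by have [//|<-] := rmact_in_jclass m sJ; exact: submod_act.
apply: freeL_ind => [||y yJ]; [exact: submod0 | exact: submodD |].
by have [t <-] := lbasis_trans sJ yJ; exact: submod_act.
Qed.

Lemma quot_nonzero_action (E : congruence (freeL J)) :
  proper_cong E -> nonzero_action (quot E).
Proof.
move=> [p [q Epq]]; case: regJ => e eJ ee.
apply/nonzero_actionP; exists (quot_pi E (lbasis J e)), e.
rewrite quot_rmact rmact_lbasis // ee eJ => /quot_piP Ee0; apply: Epq.
by apply: cong_trans (cong0_total eJ Ee0 p) (cong_sym (cong0_total eJ Ee0 q)).
Qed.

Lemma quot_minimal (E : congruence (freeL J)) :
  proper_cong E -> minimal_module (quot E).
Proof.
move=> Ep; have [p pE] := quot_pi_linear E.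
apply: (@minimal_image _ _ _ p) freeL_minimal (quot_nonzero_action Ep).
  by move=> x s; rewrite !pE quot_rmact.
by move=> q; have [x ->] := quot_pi_surj q; exists x; rewrite pE.
Qed.

Lemma apex_irreducible : irreducible_module (quot (apex_cong J)).
Proof.
split; last exact: quot_minimal apex_proper.
have [p pE] := quot_pi_linear (apex_cong J).
apply: (@simple_image _ _ _ p) (quot_nonzero_action apex_proper).
- by move=> x s; rewrite !pE quot_rmact.
- by move=> q; have [x ->] := quot_pi_surj q; exists x; rewrite pE.
- by move=> E Ep x y Exy; rewrite !pE; apply/quot_piP/(proper_le_apex Ep).
Qed.

(** * The rows of the structure matrix *)

(** The Clifford-Miller lemma turns the matrix, defined through idempotents, into
a multiplication table modulo the complement of J. *)
Lemma CmatE (b : Lset J) (a : Rset J) x y :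
  x \in J -> x \in val b -> y \in J -> y \in val a ->
  Cmat b a = ((x * y)%g \in J) :> bool.
Proof.
move=> xJ xb yJ ya.
have bE : val b = Lcls x.
  by have [_ bE] := lrepP b; move: xb; rewrite -bE inE => /LclsP.
have aE : val a = Rcls y by apply/eqP; rewrite -Rset_mem.
apply/existsP/idP => [[e]|].
  rewrite inE bE aE !inE => /andP[/andP[/RclsP ey /LclsP ex] /eqP ee].
  by apply/mul_jclassP => //; exists e.
case/mul_jclassP => // e ee [ex ey]; exists e.
by rewrite inE bE aE -ex -ey memLcls memRcls ee eqxx.
Qed.

Definition row_map m : coR J := \sum_b m b *: Crow b.

(** This description of the combination of rows, free of the matrix, makes both
equivariance and the computation of the kernel direct. *)
Lemma row_mapE m (a : Rset J) y : y \in val a ->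
  row_map m a = (rmact m y != 0) :> bool.
Proof.
move=> ya; have yJ := Rset_sub ya.
rewrite /row_map sum_ffunE boolsr_sum rmact_neq0.
apply: eq_existsb => b /=; have [bJ bE] := lrepP b.
rewrite !ffunE /= -(CmatE (b := b) bJ _ yJ ya) //.
by rewrite -bE memLcls.
Qed.

Lemma row_map_linear : exists f : {linear freeL J -> coR J}, f =1 row_map.
Proof.
apply: linear_of_additive => [|m n]; rewrite /row_map.
  by rewrite big1 // => b _; rewrite ffunE scale0r.
by rewrite -big_split; apply: eq_bigr => b _; rewrite ffunE scalerDl.
Qed.

(** At the R-class of y, both sides ask whether m(sy) is nonzero; if sy leaves J,
both are 0. *)
Lemma row_map_act m s : row_map (rmact m s) = rmact (row_map m) s.
Proof.
apply/ffunP => a; apply: val_inj => /=; have [aJ aE] := rrepP a.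
have ra : rrep a \in val a by rewrite -aE memRcls.
rewrite (row_mapE _ ra) -rmactM ffunE boolsr_sum.
apply/idP/existsP => [msa|[a' /andP[saa']]]; last by rewrite (row_mapE _ saa').
have saJ : (s * rrep a)%g \in J.
  move: msa; rewrite rmact_neq0 => /existsP[b /andP[_]].
  exact: jclassMr.
have saR : Rcls (s * rrep a)%g \in Rclasses J by apply/imsetP; exists (s * rrep a)%g.
pose c : Rset J := Sub (Rcls (s * rrep a)%g) saR.
have sac : (s * rrep a)%g \in val c by rewrite SubK memRcls.
by exists c; rewrite sac (row_mapE _ sac).
Qed.

(** Equality of the images compares annihilators inside J only.  This is enough:
if qs <> 0, some t in J has qst <> 0, so st is in J; but then pst = 0 gives
qst = 0. *)
Lemma ker_row_map m n : apex_cong J m n <-> row_map m = row_map n.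
Proof.
split=> [mn|mn].
  apply/ffunP => a; apply: val_inj => /=; have [_ aE] := rrepP a.
  have ra : rrep a \in val a by rewrite -aE memRcls.
  by rewrite !(row_mapE _ ra); congr (~~ _); apply/eqP/eqP => /mn.
have act0J t : t \in J -> rmact m t = 0 <-> rmact n t = 0.
  move=> tJ; have tR : Rcls t \in Rclasses J by apply/imsetP; exists t.
  have ta : t \in val (Sub (Rcls t) tR : Rset J) by rewrite SubK memRcls.
  have := congr1 (fun f : coR J => bool_of_boolsr (f (Sub (Rcls t) tR))) mn.
  rewrite /= !(row_mapE _ ta) => /negb_inj mnt.
  by split=> /eqP; [rewrite mnt|rewrite -mnt] => /eqP.
suff kill (p q : freeL J) s : (forall t, t \in J -> rmact p t = 0 -> rmact q t = 0) ->
    rmact p s = 0 -> rmact q s = 0.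
  by move=> s; split; apply: kill => t /act0J[].
move=> pq ps; apply/eqP/negP => /negP/eqP qs.
have [t tJ] := rmact_neq0_ex qs; rewrite -rmactM => qst; apply: (qst).
move/eqP: qst; rewrite rmact_neq0 => /existsP[b /andP[_ bstJ]].
by apply: pq (jclassMr tJ bstJ) _; rewrite rmactM ps rmact0.
Qed.

Lemma row_map_lbasis x (b : Lset J) : x \in J -> x \in val b ->
  row_map (lbasis J x) = Crow b.
Proof.
move=> xJ xb; apply/ffunP => a; apply: val_inj => /=; have [aJ aE] := rrepP a.
have ra : rrep a \in val a by rewrite -aE memRcls.
rewrite (row_mapE _ ra) rmact_lbasis // ffunE (CmatE xJ xb aJ ra).
case: ifP => xaJ; last by rewrite eqxx.
by apply/eqP/lbasis_neq0.
Qed.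

Lemma row_span_embedding :
  exists phi : {linear quot (apex_cong J) -> coR J},
    [/\ equivariant phi,
        injective phi,
        (forall f : coR J, row_span f <-> exists q, phi q = f)
      & forall x (b : Lset J), x \in J -> x \in val b ->
          phi (quot_pi (apex_cong J) (lbasis J x)) = Crow b].
Proof.
have [f fE] := row_map_linear.
have [||h [h_act h_inj hE]] := @quot_lift _ _ _ f (apex_cong J).
- by move=> m s; rewrite !fE row_map_act.
- by move=> m n; rewrite !fE; exact: ker_row_map.
exists h; split=> // [g|x b xJ xb]; last by rewrite hE fE; exact: row_map_lbasis.
split=> [[c ->]|[q <-]].
  exists (quot_pi (apex_cong J) [ffun b => c b]); rewrite hE fE.
  by apply: eq_bigr => b _; rewrite ffunE.
by have [m ->] := quot_pi_surj q; exists m; rewrite hE fE.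
Qed.

End FreeModule.

(** * Minimal modules are covered by free modules *)

Section Cover.
Variables (S : finSemigroupType) (M : rmodType S).

(** Take m, s with ms <> 0 and let w be the sum of all the mt.  The elements below
w form a submodule, as wt is below w, and it contains ms. *)
Lemma minimal_top : minimal_module M -> exists w : M, forall m, m + w = w.
Proof.
move=> [/nonzero_actionP[m [s ms]] minM].
pose w := \sum_t rmact m t; exists w.
have le_w t : rmact m t + w = w by rewrite /w (bigD1 t) //= addrA addxx.
have dD x y : x + w = w -> y + w = w -> (x + y) + w = w.
  by move=> xw yw; rewrite -addrA yw.
have dA x t : x + w = w -> rmact x t + w = w.
  move=> xw; have wt : rmact w t + w = w.
    rewrite /w rmact_sum; elim/big_ind: _ => [|y z|u _]; first exact: add0r.
      exact: dD.
    by rewrite -rmactM; exact: le_w.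
  by rewrite -[in LHS]wt addrA -rmactD xw.
have [N0|//] := minM (@Submodule _ _ (fun x => x + w = w) (add0r w) dD dA).
by case: ms; apply/N0; exact: le_w.
Qed.

(** The homomorphism sends the L-class of x to wx, with w the largest element of M:
if x = uy, then wx = (wu)y <= wy, so wx = wy when x and y are L-related.
Minimality of the ideal of s makes w(xt) vanish as soon as x is in J and xt is
not, matching the action on the free module. *)
Lemma minimal_cover : minimal_module M ->
  exists J : jclass S, regular_jclass J /\
  exists f : {linear freeL J -> M},
    equivariant f /\ forall y, exists x, f x = y.
Proof.
move=> minM; have [w w_top] := minimal_top minM.
have [/nonzero_actionP[m0 [s0 ms0]] sub] := minM.
have top0 (m : M) s : rmact w s = 0 -> rmact m s = 0.
  by rewrite -(w_top m) rmactD => /addx_eq0[].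
have ws0 : rmact w s0 != 0 by apply/eqP => /top0.
have [s ws s_min] : exists2 s, rmact w s != 0 &
    forall t, rmact w t != 0 -> #|pideal s| <= #|pideal t|.
  have := @arg_minnP S s0 (fun s => rmact w s != 0) (fun s => #|pideal s|) ws0.
  by case=> s; exists s.
pose J : jclass S := JClass (ex_intro _ s erefl).
have killP x y : y \in pideal x -> rmact w y != 0 -> rmact w x != 0.
  case/imset2P => u v _ _ -> /eqP wy; apply/eqP => wx; apply: wy.
  have wux : rmact w (adjl u x) = 0 by case: u => //= u; rewrite rmactM; exact: top0.
  by case: v => //= v; rewrite rmactM wux rmact0.
have sJ : s \in J by rewrite inE.
have wJ x : x \in J -> rmact w x != 0.
  by move=> xJ; apply: killP ws; rewrite -(jclass_ideal sJ xJ) mem_ideal.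
have w_fall x t : x \in J -> (x * t)%g \notin J -> rmact w (x * t)%g = 0.
  move=> xJ; apply: contraNeq => wxt; rewrite (mem_jclass _ xJ) eq_sym eqEcard.
  rewrite ideal_sub; last by apply/imset2P; exists None (Some t).
  by rewrite -(jclass_ideal sJ xJ) s_min.
have w_le x y : Lcls x = Lcls y -> rmact w x + rmact w y = rmact w y.
  move/Lcls_lideal/imsetP => [[u|] _ ->] /=; last exact: addxx.
  by rewrite rmactM -rmactD w_top.
have w_L x y : Lcls x = Lcls y -> rmact w x = rmact w y.
  by move=> xy; rewrite -(w_le _ _ xy) addrC w_le.
pose g (m : freeL J) : M := \sum_b m b *: rmact w (lrep b).
have [||f fg] := @linear_of_additive _ _ g.
- by rewrite /g big1 // => b _; rewrite ffunE scale0r.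
- move=> m n; rewrite /g -big_split.
  by apply: eq_bigr => b _; rewrite ffunE scalerDl.
have fB x : x \in J -> f (lbasis J x) = rmact w x.
  move=> xJ; have xL : Lcls x \in Lclasses J by apply/imsetP; exists x.
  rewrite fg /g (bigD1 (Sub (Lcls x) xL : Lset J)) //= big1 ?addr0 => [|b bx].
    rewrite ffunE scale_boolsr /= eqxx; apply: w_L.
    by have [_ ->] := lrepP (Sub (Lcls x) xL : Lset J).
  rewrite ffunE scale_boolsr /= ifF //; apply: contraNF bx => /eqP bx.
  by apply/eqP/val_inj.
have f_act : equivariant f.
  move=> m t; elim/freeL_ind: m => [|m n fm fn|x xJ].
  - by rewrite rmact0 linear0 rmact0.
  - by rewrite rmactD !linearD rmactD fm fn.
  rewrite rmact_lbasis // (fB x xJ) -rmactM.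
  by case: ifPn => [/fB //|xtJ]; rewrite linear0 w_fall.
have f_surj y : exists x, f x = y.
  have i0 : exists x, f x = 0 by exists 0; rewrite linear0.
  have iD a b : (exists x, f x = a) -> (exists x, f x = b) -> exists x, f x = a + b.
    by move=> [x <-] [x' <-]; exists (x + x'); rewrite linearD.
  have iA a t : (exists x, f x = a) -> exists x, f x = rmact a t.
    by move=> [x <-]; exists (rmact x t); rewrite f_act.
  have [N0|all] := sub (@Submodule _ _ (fun y => exists x, f x = y) i0 iD iA);
    last exact: all.
  by case/eqP: ws; apply/N0; exists (lbasis J s); exact: fB.
exists J; split; last by exists f.
(* Write w as the image of m.  As ms <> 0, some b in J has bs in J, and the
   Clifford-Miller lemma provides an idempotent. *)
have [m mw] := f_surj w.
have : rmact m s != 0.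
  by apply/eqP => ms; case/eqP: ws; rewrite -mw -f_act ms linear0.
rewrite rmact_neq0 => /existsP[b /andP[_ bsJ]]; have [bJ _] := lrepP b.
have [e ee [eb _]] := (mul_jclassP bJ sJ).1 bsJ.
by exists e => //; rewrite (jclass_Lcls J eb).
Qed.

End Cover.

Theorem theorem4p4 (S : finSemigroupType) :
  (forall J : jclass S, regular_jclass J ->
     [/\ unique_maximal_proper (apex_cong J),
         minimal_module (freeL J)
           /\ (forall E : congruence (freeL J),
                 proper_cong E -> minimal_module (quot E)),
         irreducible_module (quot (apex_cong J))
       & exists phi : {linear quot (apex_cong J) -> coR J},
           [/\ equivariant phi,
               injective phi,
               (forall f : coR J, row_span f <-> exists q, phi q = f)
             & forall (x : S) (b : Lset J), x \in J -> x \in val b ->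
                 phi (quot_pi (apex_cong J) (lbasis J x)) = Crow b]])
  /\ (forall M : rmodType S,
        minimal_module M <->
        exists J : jclass S, regular_jclass J /\
          exists E : congruence (freeL J), proper_cong E /\ isomorphic M (quot E))
  /\ (forall M : rmodType S,
        irreducible_module M <->
        exists J : jclass S, regular_jclass J /\ isomorphic M (quot (apex_cong J))).
Proof.
split; last split.
- move=> J regJ; split.
  + exact: apex_unique_maximal.
  + by split; [exact: freeL_minimal | move=> E; exact: quot_minimal].
  + exact: apex_irreducible.
  + exact: row_span_embedding.
- move=> M; split=> [minM|[J [regJ [E [Ep ME]]]]]; last first.
    exact: minimal_isomorphic ME (quot_minimal regJ Ep).
  have [J [regJ [f [f_act f_surj]]]] := minimal_cover minM.
  have [E kerE] := ker_cong f_act.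
  exists J; split=> //; exists E; split; last exact: first_isomorphism kerE.
  exact: (ker_proper f_surj minM.1 kerE).
- move=> M; split=> [[simM minM]|[J [regJ ME]]]; last first.
    have [simA minA] := apex_irreducible regJ.
    by split; [exact: simple_isomorphic ME simA | exact: minimal_isomorphic ME minA].
  have [J [regJ [f [f_act f_surj]]]] := minimal_cover minM.
  have [E kerE] := ker_cong f_act.
  have Ep : proper_cong E := ker_proper f_surj minM.1 kerE.
  have ker_apex x y : f x = f y -> apex_cong J x y.
    by move/kerE; exact: proper_le_apex.
  exists J; split=> //; apply: (first_isomorphism f_act f_surj) => x y.
  split; last exact: ker_apex.
  exact: (ker_maximal f_act f_surj simM (apex_proper regJ) ker_apex).
Qed.
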